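(* For every integer $n\geq 2$, the degree-Kirchhoff index of the pentagonal cylinder chain $P_n$ and of the pentagonal Möbius chain $P'_n$ are \[ \operatorname{Kf}^*(P_n)=14n\left(\frac{49n^2+42n-19}{42}+ \frac{\frac{7\sqrt{6}n}{8}\left[\left(\sqrt{3}+\sqrt{2}\right)^{2n}-\left(\sqrt{3}-\sqrt{2}\right)^{2n}\right]}{(\sqrt{3}+\sqrt{2})^{2n}+(\sqrt{3}-\sqrt{2})^{2n}-2}\right), \] \[ \operatorname{Kf}^*(P'_n)=14n\left(\frac{49n^2+42n-19}{42}+ \frac{\frac{7\sqrt{6}n}{8}\left[\left(\sqrt{3}+\sqrt{2}\right)^{2n}-\left(\sqrt{3}-\sqrt{2}\right)^{2n}\right]}{(\sqrt{3}+\sqrt{2})^{2n}+(\sqrt{3}-\sqrt{2})^{2n}+2}\right). \]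
   Context: For $n\geq 2$, both graphs have vertex set $\{u_1,\dots,u_{2n}\}\cup\{u'_1,\dots,u'_{2n}\}\cup\{w_1,\dots,w_n\}$ ($5n$ vertices). Common edges: $u_ku_{k+1}$ and $u'_ku'_{k+1}$ for $1\le k\le 2n-1$; $u_{2k-1}u'_{2k-1}$ for $1\le k\le n$; $u_{2k}w_k$ and $w_ku'_{2k}$ for $1\le k\le n$. The pentagonal cylinder chain $P_n$ additionally has edges $u_{2n}u_1$ and $u'_{2n}u'_1$; the pentagonal Möbius chain $P'_n$ instead additionally has edges $u_{2n}u'_1$ and $u'_{2n}u_1$. Both have $7n$ edges; $w_k$ have degree 2, all other vertices degree 3. For a connected simple graph $G=(V,E)$ with vertex degrees $d_i$, the normalized Laplacian $\mathcal{L}(G)$ has entries $1$ on the diagonal, $-1/\sqrt{d_id_j}$ if $v_i\sim v_j$, and $0$ otherwise; if its eigenvalues are $0=\lambda_1<\lambda_2\le\cdots\le\lambda_{|V|}$, the degree-Kirchhoff index is $\operatorname{Kf}^*(G)=\frac12\sum_{i,j} d_id_jr_{ij}$ ($r_{ij}$ the effective resistance between $v_i,v_j$ with unit edge resistances), which equals $2|E|\sum_{i=2}^{|V|}1/\lambda_i$. *)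

(* Defs.v *)
From mathcomp Require Import all_boot all_order all_algebra.
Set Implicit Arguments.
Unset Strict Implicit.
Unset Printing Implicit Defensive.
Import Order.TTheory GRing.Theory Num.Theory.
Local Open Scope ring_scope.

(* A simple graph is a symmetric irreflexive relation e on a finType T.       *)

Definition degree (T : finType) (e : rel T) (x : T) : nat := #|[pred y | e x y]|.

Definition laplacian (R : nzRingType) (T : finType) (e : rel T) : 'M[R]_#|T| :=
  \matrix_(i, j) ((degree e (enum_val i))%:R *+ (i == j)
                  - (e (enum_val i) (enum_val j))%:R).

(* Kirchhoff's node law for the potential v when every edge is a unit         *)
(* resistor and a unit current enters the network at x and leaves it at y.    *)
Definition unit_current_potential (R : nzRingType) (T : finType) (e : rel T)
    (x y : T) (v : T -> R) : Prop :=
  forall z, \sum_(t | e z t) (v z - v t) = (z == x)%:R - (z == y)%:R.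

(* A solution v of v *m laplacian R e = 1_x - 1_y (the node law; the          *)
(* Laplacian of a graph is symmetric) whenever this system is solvable.       *)
Definition potential (R : fieldType) (T : finType) (e : rel T) (x y : T) :
    'rV[R]_#|T| :=
  (delta_mx 0 (enum_rank x) - delta_mx 0 (enum_rank y))
    *m pinvmx (laplacian R e).

(* On a connected graph this is v x - v y for one, equivalently every, v with *)
(* unit_current_potential e x y v : see potentialP, effective_resistanceE.    *)
Definition effective_resistance (R : fieldType) (T : finType) (e : rel T)
    (x y : T) : R :=
  potential R e x y 0 (enum_rank x) - potential R e x y 0 (enum_rank y).

Definition degree_kirchhoff (R : fieldType) (T : finType) (e : rel T) : R :=
  2%:R^-1 * \sum_(x : T) \sum_(y : T)
    ((degree e x)%:R * (degree e y)%:R * effective_resistance R e x y).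

Section EffectiveResistance.

Variables (R : realFieldType) (T : finType) (e : rel T).
Hypotheses (sym_e : symmetric e) (conn_e : forall x y, connect e x y).

Lemma mul_laplacianE (v : 'rV[R]_#|T|) (z : T) :
  (v *m laplacian R e) 0 (enum_rank z)
  = \sum_(t | e z t) (v 0 (enum_rank z) - v 0 (enum_rank t)).
Proof.
rewrite mxE sumrB sumr_const -mulr_natr.
under eq_bigr => i _ do rewrite mxE mulrBr.
rewrite sumrB; congr (_ - _).
  rewrite (bigD1 (enum_rank z)) //= eqxx enum_rankK mulr1n big1 ?addr0 //.
  by move=> i /negbTE->; rewrite mulr0n mulr0.
rewrite (reindex (@enum_rank T)) /=; last first.
  by exists enum_val => i _; rewrite ?enum_rankK ?enum_valK.
rewrite [RHS]big_mkcond; apply: eq_bigr => t _.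
by rewrite !enum_rankK sym_e; case: (e z t); rewrite ?mulr1 ?mulr0.
Qed.

Lemma harmonic_const (v : T -> R) :
  (forall z, \sum_(t | e z t) (v z - v t) = 0) -> forall x y, v x = v y.
Proof.
move=> hv.
have sq0 : \sum_z \sum_(t | e z t) (v z - v t) ^+ 2 = 0.
  have A : \sum_z \sum_(t | e z t) v z * (v z - v t) = 0.
    by apply: big1 => z _; rewrite -mulr_sumr hv mulr0.
  have B : \sum_z \sum_(t | e z t) v t * (v z - v t) = 0.
    rewrite (exchange_big_dep predT) //=; apply: big1 => t _.
    rewrite -mulr_sumr (eq_bigl (e t)) => [|z]; last exact: sym_e.
    rewrite (eq_bigr (fun z => - (v t - v z))) => [|z _]; last by rewrite opprB.
    by rewrite sumrN hv oppr0 mulr0.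
  transitivity (\sum_z \sum_(t | e z t) v z * (v z - v t)
                - \sum_z \sum_(t | e z t) v t * (v z - v t)).
    rewrite -sumrB; apply: eq_bigr => z _.
    by rewrite -sumrB; apply: eq_bigr => t _; rewrite -mulrBl expr2.
  by rewrite A B subrr.
have ve z t : e z t -> v z = v t.
  move=> ezt; apply/eqP; rewrite -subr_eq0 -sqrf_eq0.
  have ge0 w : 0 <= \sum_(s | e w s) (v w - v s) ^+ 2.
    by apply: sumr_ge0 => s _; apply: sqr_ge0.
  have hz := @psumr_eq0P _ _ _ _ (fun w _ => ge0 w) sq0 z isT.
  by rewrite (psumr_eq0P _ hz ezt) // => s _; apply: sqr_ge0.
move=> x y; have /connectP[p + ->] := conn_e x y.
by elim: p x => //= t p IHp x /andP[/ve-> /IHp].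
Qed.

Lemma potentialP (x y : T) :
  unit_current_potential e x y (fun z => potential R e x y 0 (enum_rank z)).
Proof.
move=> z; rewrite -mul_laplacianE mulmxKpV; last first.
  rewrite submxE mulmxBl -!rowE; apply/eqP/rowP => j; rewrite !mxE.
  apply/eqP; rewrite subr_eq0; apply/eqP.
  pose w : 'rV[R]_#|T| := (col j (cokermx (laplacian R e)))^T.
  have symL : (laplacian R e)^T = laplacian R e.
    apply/matrixP=> a b; rewrite !mxE sym_e eq_sym.
    by case: eqP => // ->.
  have w0 : w *m laplacian R e = 0.
    by rewrite /w -{2}symL -trmx_mul colE mulmxA mulmx_coker mul0mx trmx0.
  have hw u : \sum_(t | e u t) (w 0 (enum_rank u) - w 0 (enum_rank t)) = 0.
    by rewrite -mul_laplacianE w0 mxE.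
  by have := harmonic_const hw x y; rewrite !mxE.
by rewrite !mxE !eqxx /= !(inj_eq enum_rank_inj).
Qed.

Lemma effective_resistanceE (x y : T) (v : T -> R) :
  unit_current_potential e x y v -> effective_resistance R e x y = v x - v y.
Proof.
move=> hv; apply/eqP; rewrite -subr_eq0 /effective_resistance; apply/eqP.
set p := potential R e x y; pose d z := p 0 (enum_rank z) - v z.
have /harmonic_const/(_ x y): forall z, \sum_(t | e z t) (d z - d t) = 0.
  move=> z; rewrite -[RHS](subrr ((z == x)%:R - (z == y)%:R)).
  rewrite -{1}(potentialP x y z) -hv -sumrB; apply: eq_bigr => t _.
  by rewrite /d [in RHS]opprB opprB addrACA [RHS]addrACA [- v z + _]addrC.
by rewrite /d => /eqP; rewrite -subr_eq0 => /eqP <-; rewrite !opprB addrACA [RHS]addrACA [- v x + _]addrC.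
Qed.

End EffectiveResistance.

(* U i, U' i : 'I_(2 * n) and W k : 'I_n are the vertices u_{i+1}, u'_{i+1}   *)
(* and w_{k+1}; the conditions below are on the one-based labels i.+1, k.+1.  *)
Definition vertex (n : nat) : finType := ('I_(2 * n) + 'I_(2 * n) + 'I_n)%type.

Local Notation U i := (inl (inl i)).
Local Notation U' i := (inl (inr i)).
Local Notation W k := (inr k).

(* Each arc relation lists every edge in one direction.                       *)
Definition common_arc (n : nat) (x y : vertex n) : bool :=
  match x, y with
  | U i, U j => j.+1 == i.+2
  | U' i, U' j => j.+1 == i.+2
  | U i, U' j => (i.+1 == j.+1) && odd i.+1
  | U i, W k => i.+1 == (2 * k.+1)%N
  | W k, U' j => j.+1 == (2 * k.+1)%N
  | _, _ => false
  end.

Definition cylinder_arc (n : nat) (x y : vertex n) : bool :=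
  match x, y with
  | U i, U j => (i.+1 == 2 * n)%N && (j.+1 == 1)%N
  | U' i, U' j => (i.+1 == 2 * n)%N && (j.+1 == 1)%N
  | _, _ => false
  end.

Definition moebius_arc (n : nat) (x y : vertex n) : bool :=
  match x, y with
  | U i, U' j => (i.+1 == 2 * n)%N && (j.+1 == 1)%N
  | U' i, U j => (i.+1 == 2 * n)%N && (j.+1 == 1)%N
  | _, _ => false
  end.

Definition pentagonal_cylinder (n : nat) : rel (vertex n) := fun x y =>
  [|| common_arc x y, common_arc y x, cylinder_arc x y | cylinder_arc y x].

Definition pentagonal_moebius (n : nat) : rel (vertex n) := fun x y =>
  [|| common_arc x y, common_arc y x, moebius_arc x y | moebius_arc y x].

Lemma pentagonal_cylinder_sym n : symmetric (@pentagonal_cylinder n).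
Proof.
move=> x y; rewrite /pentagonal_cylinder orbCA.
by rewrite [cylinder_arc x y || _]orbC.
Qed.

Lemma pentagonal_moebius_sym n : symmetric (@pentagonal_moebius n).
Proof.
move=> x y; rewrite /pentagonal_moebius orbCA.
by rewrite [moebius_arc x y || _]orbC.
Qed.

Lemma pentagonal_cylinder_irr n : irreflexive (@pentagonal_cylinder n).
Proof.
have H (i : nat) : (i.+1 == 2 * n)%N && (i.+1 == 1)%N = false.
  by apply/negP => /andP[/eqP-> /eqP]; case: n => // m; rewrite mulnS.
by move=> [[i|i]|k]; rewrite /pentagonal_cylinder /= ?H // ltn_eqF.
Qed.

Lemma pentagonal_moebius_irr n : irreflexive (@pentagonal_moebius n).
Proof. by move=> [[i|i]|k]; rewrite /pentagonal_moebius //= ltn_eqF. Qed.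

(* Main.v *)
Require Import Defs.
From mathcomp Require Import all_boot all_order all_algebra.
From mathcomp Require Import zify ring lra.
Import Order.TTheory GRing.Theory Num.Theory.
Set Implicit Arguments.
Unset Strict Implicit.
Unset Printing Implicit Defensive.
Local Open Scope ring_scope.

(* If a symmetric function g satisfies L (g x) = vol * 1_x - deg for all x, L
   being the Laplacian and vol the sum of the degrees, then
   r_xy = (g x x + g y y - 2 g x y) / vol, and sum_y deg y * g x y does not
   depend on x; hence Kf* = sum_x deg x * g x x - sum_y deg y * g x0 y for any
   x0. For both chains such a g is explicit. Split potentials under the
   exchange of the rails u and u'. The symmetric part lives on a 2n-cycle,
   where it is the parabola 7/4 (k^2 - 2 n k) in the distance k up to a
   correction depending on the parity, and it is the same for both chains. The
   antisymmetric part vanishes at the w_k, is periodic for the cylinder and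
   antiperiodic for the Moebius chain, and after rescaling satisfies
   y (k + 2) + y k = 2 sqrt 3 y (k + 1), whose characteristic roots are
   sqrt 3 + sqrt 2 and sqrt 3 - sqrt 2. *)

(** * The degree-Kirchhoff index expressed through a Green function *)

Section GreenFunction.

Variables (R : realFieldType) (T : finType) (e : rel T).
Hypothesis sym_e : symmetric e.

Definition node_flow (f : T -> R) (z : T) : R := \sum_(t | e z t) (f z - f t).

Lemma node_flow_selfadjoint (f h : T -> R) :
  \sum_z h z * node_flow f z = \sum_z f z * node_flow h z.
Proof.
have E (f1 h1 : T -> R) : \sum_z h1 z * node_flow f1 z =
    \sum_z \sum_(t | e z t) h1 z * f1 z - \sum_z \sum_(t | e z t) h1 z * f1 t.
  rewrite -sumrB; apply: eq_bigr => z _.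
  by rewrite mulr_sumr -sumrB; apply: eq_bigr => t _; rewrite mulrBr.
rewrite !E; congr (_ - _).
  by apply: eq_bigr => z _; apply: eq_bigr => t _; rewrite mulrC.
rewrite (exchange_big_dep predT) //=; apply: eq_bigr => z _.
by apply: eq_big => [t|t _]; [exact: sym_e | rewrite mulrC].
Qed.

Variables (vol : R) (g : T -> T -> R).
Hypothesis deg_gt0 : forall x, (0 < degree e x)%N.
Hypothesis flow_g :
  forall x z, node_flow (g x) z = vol * (z == x)%:R - (degree e z)%:R.

Lemma sum_delta (x : T) (F : T -> R) : \sum_z F z * (z == x)%:R = F x.
Proof.
rewrite (bigD1 x) //= eqxx mulr1 big1 ?addr0 // => z /negbTE->.
by rewrite mulr0.
Qed.

Lemma sum_flow_green (h : T -> R) (x : T) :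
  \sum_z g x z * node_flow h z = vol * h x - \sum_z h z * (degree e z)%:R.
Proof.
rewrite -node_flow_selfadjoint.
under eq_bigr => z _ do rewrite flow_g mulrBr mulrCA.
by rewrite sumrB -mulr_sumr sum_delta.
Qed.

(* Pairing [g x] with the indicator of the component of [x], which carries no
   flow, shows that this component already has the volume of the graph. *)
Lemma component_volume (x : T) (C : pred T) :
  C x -> (forall z t, e z t -> C z = C t) -> vol = \sum_(z | C z) (degree e z)%:R.
Proof.
move=> Cx clC; have := sum_flow_green (fun z => (C z)%:R) x.
rewrite Cx mulr1 big1 => [/esym/eqP|z _].
  rewrite subr_eq0 => /eqP->; rewrite [RHS]big_mkcond; apply: eq_bigr => z _.
  by case: (C z); rewrite ?mul1r ?mul0r.
by rewrite /node_flow big1 ?mulr0 // => t /clC->; rewrite subrr.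
Qed.

(** The component of [x] already has the full volume, so the degrees outside it sum to 0, while
    [deg_gt0] makes each of them positive. *)
Lemma green_connected (x y : T) : connect e x y.
Proof.
apply/negPn/negP => nxy.
have volT := component_volume (C := predT) (x := x) isT (fun _ _ _ => erefl).
have clC z t : e z t -> connect e x z = connect e x t.
  move=> ezt; apply/idP/idP => h; apply: (connect_trans h); apply: connect1 => //.
  by rewrite sym_e.
have := component_volume (connect0 e x) clC; rewrite volT (bigID (connect e x)) /=.
move/eqP; rewrite -subr_eq0 addrAC subrr add0r => /eqP sum0.
have /eqP := psumr_eq0P (fun _ _ => ler0n _ _) sum0 nxy.
by rewrite pnatr_eq0 -[_ == _]negbK -lt0n deg_gt0.
Qed.

Hypothesis sym_g : forall x y, g x y = g y x.

Lemma green_degree_kirchhoff (x0 : T) :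
  degree_kirchhoff R e =
  \sum_x (degree e x)%:R * g x x - \sum_y (degree e y)%:R * g x0 y.
Proof.
have volT : vol = \sum_z (degree e z)%:R by apply: (component_volume (C := predT) (x := x0)).
have vol0 : vol != 0.
  rewrite gt_eqF // volT (bigD1 x0) //= ltr_pwDl ?ltr0n //.
  by apply: sumr_ge0 => z _; rewrite ler0n.
(* Evaluating the pairing of [g x] with the flow of [g x0] in two ways yields [vol * g x x0] on both
   sides; it cancels and leaves the two weighted sums. *)
have mean x : \sum_y (degree e y)%:R * g x y = \sum_y (degree e y)%:R * g x0 y.
  have := sum_flow_green (g x0) x.
  under eq_bigr => z _ do rewrite flow_g mulrBr mulrCA.
  rewrite sumrB -mulr_sumr sum_delta (sym_g x x0) => /(addrI _)/oppr_inj E.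
  by under eq_bigr => y _ do rewrite mulrC; rewrite E; apply: eq_bigr => y _; rewrite mulrC.
have res x y : effective_resistance R e x y
    = vol^-1 * (g x x + g y y - g x y - g x y).
  (* The degree terms cancel in the difference of two Green functions, so after division by [vol] a
     unit current from [x] to [y] remains. *)
  rewrite (effective_resistanceE sym_e green_connected
             (v := fun z => vol^-1 * (g x z - g y z))).
    by rewrite (sym_g y x); ring.
  move=> z; have -> : (z == x)%:R - (z == y)%:R =
      vol^-1 * (node_flow (g x) z - node_flow (g y) z) :> R.
    by rewrite !flow_g; field.
  rewrite -sumrB mulr_sumr; apply: eq_bigr => t _; ring.
rewrite /degree_kirchhoff.
have -> : \sum_x \sum_y (degree e x)%:R * (degree e y)%:R * effective_resistance R e x y
  = \sum_x (vol^-1 * ((degree e x)%:R * g x x * vol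
     + (degree e x)%:R * (\sum_y (degree e y)%:R * g y y)
     - 2%:R * ((degree e x)%:R * \sum_y (degree e y)%:R * g x0 y))).
  apply: eq_bigr => x _; rewrite -(mean x) volT !mulr_sumr -big_split /= -sumrB mulr_sumr.
  by rewrite -volT; apply: eq_bigr => y _; rewrite res; ring.
rewrite -mulr_sumr sumrB big_split /= -!mulr_suml -mulr_sumr -mulr_suml -volT.
by field.
Qed.

End GreenFunction.

(** * Both chains in common coordinates, with explicit neighbour lists *)

Definition chain (tw : bool) (n : nat) : rel (vertex n) :=
  if tw then @pentagonal_moebius n else @pentagonal_cylinder n.

Lemma chain_sym tw n : symmetric (@chain tw n).
Proof. by case: tw; [exact: pentagonal_moebius_sym | exact: pentagonal_cylinder_sym]. Qed.

Definition rail n (b : bool) (i : 'I_(2 * n)) : vertex n :=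
  if b then inl (inr i) else inl (inl i).
Arguments rail : simpl never.

Lemma hub_index_subproof n (i : 'I_(2 * n)) : (i./2 < n)%N.
Proof. by have := ltn_ord i; lia. Qed.

Lemma foot_index_subproof n (k : 'I_n) : ((2 * k).+1 < 2 * n)%N.
Proof. by have := ltn_ord k; lia. Qed.

Definition hub n (i : 'I_(2 * n)) : vertex n := inr (Ordinal (hub_index_subproof i)).
Definition foot n (k : 'I_n) : 'I_(2 * n) := Ordinal (foot_index_subproof k).

(* Positions are zero-based, so the vertices labelled evenly are those at odd
   positions. *)
Definition rung n b (i : 'I_(2 * n)) : vertex n :=
  if odd i then hub i else rail (~~ b) i.

Lemma eq_rail n b c (i j : 'I_(2 * n)) :
  (rail b i == rail c j) = (b == c) && (i == j :> nat).
Proof. by case: b; case: c. Qed.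

Lemma eq_rail_inr n b (i : 'I_(2 * n)) (k : 'I_n) :
  (rail b i == inr k :> vertex n) = false.
Proof. by case: b. Qed.

Lemma eq_inr_rail n b (i : 'I_(2 * n)) (k : 'I_n) :
  (inr k == rail b i :> vertex n) = false.
Proof. by case: b. Qed.

Lemma eq_inr n (k l : 'I_n) : (inr k == inr l :> vertex n) = (k == l :> nat).
Proof. by []. Qed.

Lemma vertexP n (P : vertex n -> Prop) :
  (forall b i, P (rail b i)) -> (forall k, P (inr k)) -> forall x, P x.
Proof. by move=> Pr Pw [[i|i]|k]; [apply: (Pr false)|apply: (Pr true)|]. Qed.

Lemma val_ordS m (i : 'I_m) : ordS i = (if i.+1 == m then 0 else i.+1)%N :> nat.
Proof.
rewrite /=; case: eqP => [->|ne]; first by rewrite modnn.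
by rewrite modn_small //; have := ltn_ord i; lia.
Qed.

Lemma val_ord_pred m (i : 'I_m) : ord_pred i = (if i == 0 :> nat then m.-1 else i.-1) :> nat.
Proof.
have := ltn_ord i; rewrite /=; case: eqP => [->|ne] lt; first by rewrite modn_small //; lia.
by rewrite (_ : (i + m).-1 = (i.-1 + m)%N) ?modnDr ?modn_small //; lia.
Qed.

Section Neighbours.

Variables (tw : bool) (n : nat).
Hypothesis n_gt1 : (1 < n)%N.

(** The twist exchanges the rails only across the seam between positions [2 * n - 1] and 0, hence
    the exclusive or on the rail bit. *)
Definition rail_nbrs b (i : 'I_(2 * n)) : seq (vertex n) :=
  [:: rail (b (+) (tw && (i.+1 == 2 * n)%N)) (ordS i);
      rail (b (+) (tw && (i == 0 :> nat))) (ord_pred i); rung b i].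

Definition hub_nbrs (k : 'I_n) : seq (vertex n) :=
  [:: rail false (foot k); rail true (foot k)].

Lemma chain_rail b i t : chain tw (rail b i) t = (t \in rail_nbrs b i).
Proof.
have := ltn_ord i; move: t; apply: vertexP => [c j|k]; rewrite !inE.
  rewrite !eq_rail val_ordS val_ord_pred /rung /chain /hub; have := ltn_ord j.
  have [oi|oi] := boolP (odd i); rewrite ?eq_rail ?eq_rail_inr;
  case: (eqVneq i.+1 (2 * n)%N) => e1; case: (eqVneq (i : nat) 0%N) => e2;
  case: tw; case: b; case: c;
  rewrite /rail /pentagonal_moebius /pentagonal_cylinder /=; lia.
rewrite !eq_inr_rail /rung /chain /hub; have := ltn_ord k.
have [oi|oi] := boolP (odd i); rewrite ?eq_inr_rail ?eq_inr /=;
case: tw; case: b; rewrite /rail /pentagonal_moebius /pentagonal_cylinder /=; lia.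
Qed.

Lemma chain_hub k t : chain tw (inr k) t = (t \in hub_nbrs k).
Proof.
rewrite chain_sym; move: t; apply: vertexP => [c j|l].
  rewrite chain_rail !inE !eq_inr_rail /rung !eq_rail /=.
  have [oi|oi] := boolP (odd j); rewrite ?eq_inr_rail ?eq_inr /=; case: c; lia.
by rewrite /chain /hub_nbrs !inE !eq_inr_rail; case: tw.
Qed.

(** For [n = 1] the successor and the predecessor on the untwisted cycle would coincide; [n_gt1]
    excludes this. *)
Lemma uniq_rail_nbrs b i : uniq (rail_nbrs b i).
Proof.
have := ltn_ord i; rewrite /rail_nbrs /rung /hub /= !inE.
have [oi|oi] := boolP (odd i); rewrite ?eq_rail ?eq_rail_inr val_ordS val_ord_pred;
case: (eqVneq i.+1 (2 * n)%N) => e1; case: (eqVneq (i : nat) 0%N) => e2;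
case: tw; case: b => /=; lia.
Qed.

Lemma uniq_hub_nbrs k : uniq (hub_nbrs k).
Proof. by []. Qed.

Lemma degree_rail b i : degree (chain tw (n := n)) (rail b i) = 3.
Proof.
rewrite /degree -[3]/(size (rail_nbrs b i)) -(card_uniqP (uniq_rail_nbrs b i)).
by apply: eq_card => t; rewrite !inE chain_rail !inE.
Qed.

Lemma degree_hub k : degree (chain tw (n := n)) (inr k) = 2.
Proof.
rewrite /degree -[2]/(size (hub_nbrs k)) -(card_uniqP (uniq_hub_nbrs k)).
by apply: eq_card => t; rewrite !inE chain_hub !inE.
Qed.

Lemma node_flow_rail (R : realFieldType) (f : vertex n -> R) b i :
  node_flow (chain tw (n := n)) f (rail b i)
  = \sum_(t <- rail_nbrs b i) (f (rail b i) - f t).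
Proof.
rewrite big_uniq ?uniq_rail_nbrs //; apply: eq_bigl => t; exact: chain_rail.
Qed.

Lemma node_flow_hub (R : realFieldType) (f : vertex n -> R) k :
  node_flow (chain tw (n := n)) f (inr k)
  = \sum_(t <- hub_nbrs k) (f (inr k) - f t).
Proof.
rewrite big_uniq ?uniq_hub_nbrs //; apply: eq_bigl => t; exact: chain_hub.
Qed.

End Neighbours.

(** * Second-order recurrences in the distance |i - j| *)

Definition gap (i j : nat) : nat := ((i - j) + (j - i))%N.

Lemma gapC i j : gap i j = gap j i. Proof. by rewrite /gap addnC. Qed.

(** Away from the diagonal the two shifted gaps lie one below and one above [gap i j]; on it both
    equal 1, and the condition on [f 1] produces the source [e]. *)
Lemma gap_neighbours (R : comNzRingType) (f : nat -> R) (c d e : R) (i j : nat) :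
  f 1 *+ 2 = c * f 0 + d + e ->
  (forall k, f k.+2 + f k = c * f k.+1 + d) ->
  f (gap i j.+1) + f (gap i.+1 j) = c * f (gap i j) + d + e * (i == j)%:R.
Proof.
move=> f1 f2; have [<-|ne] := eqVneq i j.
  by rewrite mulr1 /gap subnn subSnn subnS subnn /= -f1 mulr2n.
rewrite mulr0 addr0; have [k D] : exists k, gap i j = k.+1.
  by exists (gap i j).-1; rewrite /gap in ne *; lia.
rewrite D -f2; case: (ltngtP i j) => [lt|lt|E]; last by rewrite E eqxx in ne.
  by congr (f _ + f _); rewrite /gap in D *; lia.
by rewrite addrC; congr (f _ + f _); rewrite /gap in D *; lia.
Qed.

(** * The explicit Green function of the chains *)

Section ChainGreen.

Variables (R : realFieldType) (tw : bool) (n : nat) (s3 : R) (psi y : nat -> R).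
Hypothesis n_gt1 : (1 < n)%N.
Hypothesis s3_sqr : s3 * s3 = 3.
Hypothesis psi1 : psi 1 *+ 2 = 2 * psi 0 + 7 / 2 - 7 * n%:R.
Hypothesis psiS : forall k, psi k.+2 + psi k = 2 * psi k.+1 + 7 / 2.
Hypothesis psi_wrap : forall k, (k <= 2 * n)%N -> psi (2 * n - k) = psi k.
Hypothesis y1 : y 1 *+ 2 = 2 * s3 * y 0 - 7 * n%:R * s3 / 6.
Hypothesis yS : forall k, y k.+2 + y k = 2 * s3 * y k.+1.
Hypothesis y_wrap : forall k, (k <= 2 * n)%N -> y (2 * n - k) = (-1) ^+ tw * y k.

Definition pos (x : vertex n) : nat :=
  match x with inl (inl i) => i | inl (inr i) => i | inr k => (2 * k).+1 end.

(** The alternating 1/8 and -1/8 contribute flow 1/2 at even and -1/2 at odd positions, which turns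
    -7/2 into -3 and -4; the hub value is -1/8 - 1. *)
Definition level (x : vertex n) : R :=
  match x with
  | inr _ => - 9 / 8
  | _ => if odd (pos x) then - 1 / 8 else 1 / 8
  end.

(** An antisymmetric harmonic [v] has neighbour sum 4 v at even positions, where the rung leads to
    -v, and 3 v at odd ones, where the hub is at 0. Writing v as [weight] times [y] turns both
    factors into [2 * s3]. *)
Definition weight (i : nat) : R := if odd i then 2 else s3.

Definition charge (x : vertex n) : R :=
  match x with
  | inl (inl i) => weight i
  | inl (inr i) => - weight i
  | inr _ => 0
  end.

(** For a hub [x], [psi] puts a source [7 * n] on each of its two feet; raising the hub by [7 * n]
    moves both to the hub. *)
Definition hub_peak (x z : vertex n) : R :=
  match x, z with
  | inr k, inr l => if k == l :> nat then 7 * n%:R else 0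
  | _, _ => 0
  end.

(* The flip-invariant part [psi] of the potential solves a Poisson equation on
   the 2n-cycle; the antisymmetric part vanishes at the hubs and solves there a
   recurrence with coefficients 4 and 3, which [weight] makes constant. The
   cycle sees the sources -3 and, through a hub, -4; [level] corrects [psi],
   built for their mean -7/2, and adds the drop -1 from a rail to a hub. *)
Definition green (x z : vertex n) : R :=
  psi (gap (pos x) (pos z)) + level x + level z
  + charge x * charge z * y (gap (pos x) (pos z)) + hub_peak x z.

Lemma green_sym x z : green x z = green z x.
Proof.
rewrite /green gapC (mulrC (charge x)) -[_ + level x + level z]addrA.
rewrite (addrC (level x)) addrA; congr (_ + _).
by case: x => [[i|i]|k]; case: z => [[j|j]|l] //=; rewrite eq_sym.
Qed.

Lemma pos_lt x : (pos x < 2 * n)%N.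
Proof. by case: x => [[i|i]|k] /=; rewrite ?ltn_ord //; have := ltn_ord k; lia. Qed.

Lemma pos_rail b i : pos (rail b i) = i. Proof. by case: b. Qed.

Lemma level_rail b i : level (rail b i) = if odd i then - 1 / 8 else 1 / 8.
Proof. by case: b. Qed.

Lemma charge_rail b i : charge (rail b i) = (-1) ^+ b * weight i.
Proof. by case: b; rewrite /= ?expr1 ?expr0 ?mulN1r ?mul1r. Qed.

Lemma hub_peak_rail x b i : hub_peak x (rail b i) = 0.
Proof. by case: b; case: x => [[]|]. Qed.

Lemma odd_ordS (i : 'I_(2 * n)) : odd (ordS i) = ~~ odd i.
Proof. by rewrite val_ordS; have := ltn_ord i; case: eqP => /=; lia. Qed.

Lemma odd_ord_pred (i : 'I_(2 * n)) : odd (ord_pred i) = ~~ odd i.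
Proof. by rewrite val_ord_pred; have := ltn_ord i; case: eqP => /=; lia. Qed.

(** Past the seam, position 0 stands for [2 * n], and the reflection law of [f] accounts for the
    change of distance. The bit [tw'] is [false] for [psi] and [tw] for [y]. *)
Lemma wrap_next (f : nat -> R) (tw' : bool) (p : nat) (i : 'I_(2 * n)) :
  (forall k, (k <= 2 * n)%N -> f (2 * n - k)%N = (-1) ^+ tw' * f k) ->
  (p < 2 * n)%N ->
  (-1) ^+ (tw' && (i.+1 == 2 * n)%N) * f (gap p (ordS i)) = f (gap p i.+1).
Proof.
move=> fw lt; rewrite val_ordS; have := ltn_ord i; case: eqP => [-> _|ne _].
  by rewrite andbT -fw /gap; [congr f|]; lia.
by rewrite andbF mul1r.
Qed.

Lemma wrap_prev (f : nat -> R) (tw' : bool) (p : nat) (i : 'I_(2 * n)) :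
  (forall k, (k <= 2 * n)%N -> f (2 * n - k)%N = (-1) ^+ tw' * f k) ->
  (p < 2 * n)%N ->
  (-1) ^+ (tw' && (i == 0 :> nat)) * f (gap p (ord_pred i)) = f (gap p.+1 i).
Proof.
move=> fw lt; rewrite val_ord_pred; have := ltn_ord i; case: eqP => [-> ?|ne _].
  by rewrite andbT -fw /gap; [congr f|]; lia.
by rewrite andbF mul1r; congr f; rewrite /gap; lia.
Qed.

Lemma sum_psi_neighbours x (i : 'I_(2 * n)) :
  psi (gap (pos x) (ordS i)) + psi (gap (pos x) (ord_pred i))
  = 2 * psi (gap (pos x) i) + 7 / 2 - 7 * n%:R * (pos x == i)%:R.
Proof.
have psi_wrap0 k (hk : (k <= 2 * n)%N) : psi (2 * n - k) = (-1) ^+ false * psi k.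
  by rewrite mul1r psi_wrap.
have := wrap_next i psi_wrap0 (pos_lt x); rewrite mul1r => ->.
have := wrap_prev i psi_wrap0 (pos_lt x); rewrite mul1r => ->.
by rewrite (@gap_neighbours _ psi 2 (7 / 2) (- (7 * n%:R))) ?mulNr.
Qed.

Lemma sum_y_neighbours x b (i : 'I_(2 * n)) :
  (-1) ^+ (b (+) (tw && (i.+1 == 2 * n)%N)) * y (gap (pos x) (ordS i))
  + (-1) ^+ (b (+) (tw && (i == 0 :> nat))) * y (gap (pos x) (ord_pred i))
  = (-1) ^+ b * (2 * s3 * y (gap (pos x) i) - 7 * n%:R * s3 / 6 * (pos x == i)%:R).
Proof.
rewrite !signr_addb -!mulrA -mulrDr wrap_next ?pos_lt // wrap_prev ?pos_lt //.
rewrite (@gap_neighbours _ y (2 * s3) 0 (- (7 * n%:R * s3 / 6))) ?addr0 ?mulNr //.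
  by congr (_ * _); ring.
by move=> k; rewrite addr0 yS.
Qed.

(** The symmetric and the antisymmetric source have size [7 * n] each: they add up on the rail of
    [x] and cancel on the other one. *)
Lemma source_even x (b : bool) (i : 'I_(2 * n)) : ~~ odd i ->
  (7 * n%:R + 7 * n%:R * s3 / 3 * (charge x * (-1) ^+ b)) * (pos x == i)%:R
  = 14 * n%:R * (rail b i == x)%:R.
Proof.
move=> oi; move: x; apply: vertexP => [c j|k]; last first.
  by rewrite eq_rail_inr /= (_ : _ == _ = false) ?mulr0 //; apply/negP; lia.
rewrite pos_rail charge_rail eq_rail eq_sym; case: eqP => [E|_]; last by rewrite andbF !mulr0.
rewrite /weight -E (negbTE oi) andbT !mulr1 mulrACA.
case: b; case: c; rewrite /= ?expr0 ?expr1; by field: s3_sqr.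
Qed.

Lemma source_odd x (b : bool) (i : 'I_(2 * n)) : odd i ->
  (7 * n%:R + 7 * n%:R / 2 * (charge x * (-1) ^+ b)) * (pos x == i)%:R
    - hub_peak x (hub i)
  = 14 * n%:R * (rail b i == x)%:R.
Proof.
move=> oi; move: x; apply: vertexP => [c j|k]; last first.
  rewrite eq_rail_inr /= mul0r mulr0 addr0 mulr0; apply/eqP; rewrite subr_eq0; apply/eqP.
  rewrite (_ : ((2 * k).+1 == i) = (k == i./2 :> nat)); last by lia.
  by case: eqP => _; rewrite ?mulr1 ?mulr0.
rewrite pos_rail charge_rail eq_rail eq_sym (_ : hub_peak _ _ = 0); last by case: c.
case: eqP => [E|_]; last by rewrite andbF !mulr0 subr0.
rewrite /weight -E oi andbT !mulr1.
by case: b; case: c; rewrite /= ?expr0 ?expr1; by field.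
Qed.

Lemma source_hub x (k : 'I_n) :
  2 * hub_peak x (inr k) = 14 * n%:R * (inr k == x)%:R.
Proof.
move: x; apply: vertexP => [c j|l]; first by rewrite eq_inr_rail; case: c; rewrite /= !mulr0.
rewrite eq_inr eq_sym /=; by case: eqP => _; rewrite ?mulr1 ?mulr0 //; ring.
Qed.

Lemma node_flow_green x z :
  node_flow (chain tw (n := n)) (green x) z
  = 14 * n%:R * (z == x)%:R - (degree (chain tw (n := n)) z)%:R.
Proof.
move: z; apply: vertexP => [b i|k].
  rewrite degree_rail // node_flow_rail // /rail_nbrs !big_cons big_nil /green.
  rewrite !pos_rail !level_rail !charge_rail !hub_peak_rail odd_ordS odd_ord_pred.
  have sP := sum_psi_neighbours x i; have sY := sum_y_neighbours x b i.
  rewrite /weight odd_ordS odd_ord_pred.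
  set P1 := psi _ in sP *; set P2 := psi (gap _ (ord_pred i)) in sP *.
  set Y1 := y _ in sY *; set Y2 := y (gap _ (ord_pred i)) in sY *.
  set S1 := (-1) ^+ _ in sY *; set S2 := (-1) ^+ _ in sY *.
  have -> : P1 = 2 * psi (gap (pos x) i) + 7 / 2 - 7 * n%:R * (pos x == i)%:R - P2.
    by rewrite -sP addrK.
  have -> : charge x * (S1 * (if ~~ odd i then 2 else s3)) * Y1 =
    charge x * (if ~~ odd i then 2 else s3) * (S1 * Y1) by ring.
  have -> : S1 * Y1 = (-1) ^+ b *
      (2 * s3 * y (gap (pos x) i) - 7 * n%:R * s3 / 6 * (pos x == i)%:R) - S2 * Y2.
    by rewrite -sY addrK.
  rewrite /rung; have [oi|oi] := boolP (odd i).
    have iE : (2 * i./2).+1 = i by lia.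
    rewrite /= iE -source_odd //=; by field: s3_sqr.
  rewrite pos_rail level_rail charge_rail hub_peak_rail (negbTE oi) /weight (negbTE oi) signrN /=.
  rewrite -source_even //; by field.
rewrite degree_hub // node_flow_hub // /hub_nbrs !big_cons big_nil /green.
rewrite !pos_rail !level_rail !charge_rail !hub_peak_rail /= oddM /= -source_hub; by field.
Qed.

End ChainGreen.

(** * Evaluation of the two weighted sums of the Green function *)

Lemma sum_vertex (R : realFieldType) n (F : vertex n -> R) :
  \sum_x F x = \sum_i (F (rail false i) + F (rail true i)) + \sum_k F (inr k).
Proof. by rewrite !big_sumType big_split. Qed.

Lemma sum_alternating (R : realFieldType) (n : nat) (c d : R) :
  \sum_(i < 2 * n) (if odd i then c else d) = n%:R * (c + d).
Proof.
elim: n => [|n IHn]; first by rewrite muln0 big_ord0 mul0r.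
rewrite mulnS !addSn add0n !big_ord_recr /= IHn oddM /=; ring.
Qed.

Definition parabola (R : realFieldType) (n k : nat) : R :=
  7 / 4 * (k%:R ^+ 2 - 2 * n%:R * k%:R).

Lemma sum_parabola (R : realFieldType) (N n : nat) :
  \sum_(i < n) parabola R N i
  = 7 / 4 * n%:R * (n%:R - 1) * ((2 * n%:R - 1) / 6 - N%:R).
Proof.
elim: n => [|n IHn]; first by rewrite big_ord0; ring.
by rewrite big_ord_recr /= IHn /parabola; field.
Qed.

Lemma sum_parabola_odd (R : realFieldType) (N n : nat) :
  \sum_(k < n) parabola R N (2 * k).+1
  = 7 / 4 * n%:R * ((4 * n%:R ^+ 2 - 1) / 3 - 2 * N%:R * n%:R).
Proof.
elim: n => [|n IHn]; first by rewrite big_ord0; ring.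
by rewrite big_ord_recr /= IHn /parabola; field.
Qed.

(** On the diagonal the squared charges give [18 * y 0] or [24 * y 0] per pair of rail vertices,
    [42 * n * y 0] in all; in the row of a fixed vertex the opposite charges of the rails cancel. *)
Lemma chain_kirchhoff (R : realFieldType) (tw : bool) (n : nat) (s3 : R) (y : nat -> R) :
  (1 < n)%N -> s3 * s3 = 3 ->
  y 1 *+ 2 = 2 * s3 * y 0 - 7 * n%:R * s3 / 6 ->
  (forall k, y k.+2 + y k = 2 * s3 * y k.+1) ->
  (forall k, (k <= 2 * n)%N -> y (2 * n - k)%N = (-1) ^+ tw * y k) ->
  degree_kirchhoff R (@chain tw n)
  = 14 * n%:R * ((49 * n%:R ^+ 2 + 42 * n%:R - 19) / 42 + 3 * y 0).
Proof.
move=> n_gt1 s3_sqr y1 yS y_wrap; pose psi := parabola R n.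
have psi1 : psi 1 *+ 2 = 2 * psi 0 + 7 / 2 - 7 * n%:R by rewrite /psi /parabola; field.
have psiS k : psi k.+2 + psi k = 2 * psi k.+1 + 7 / 2 by rewrite /psi /parabola; field.
have psi_wrap k : (k <= 2 * n)%N -> psi (2 * n - k)%N = psi k.
  by move=> le; rewrite /psi /parabola natrB //; field.
have n2_gt0 : (0 < 2 * n)%N by lia.
rewrite (green_degree_kirchhoff (@chain_sym tw n) _
  (node_flow_green n_gt1 s3_sqr psi1 psiS psi_wrap y1 yS y_wrap)
  (@green_sym R n s3 psi y) (rail false (Ordinal n2_gt0))); last first.
  by apply: vertexP => [b i|k]; rewrite ?degree_rail ?degree_hub.
rewrite !sum_vertex.
have -> : \sum_i ((degree (@chain tw n) (rail false i))%:R
                    * green s3 psi y (rail false i) (rail false i)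
   + (degree (@chain tw n) (rail true i))%:R * green s3 psi y (rail true i) (rail true i))
   = \sum_(i < 2 * n) (if odd i then - 3 / 2 + 24 * y 0 else 3 / 2 + 18 * y 0) :> R.
  apply: eq_bigr => i _; rewrite !degree_rail // /green !pos_rail !level_rail !charge_rail.
  rewrite !hub_peak_rail /weight /gap subnn /psi /parabola.
  by case: (odd i); rewrite expr1 expr0; field: s3_sqr.
have -> : \sum_k (degree (@chain tw n) (inr k))%:R * green s3 psi y (inr k) (inr k)
   = \sum_(k < n) (14 * n%:R - 9 / 2) :> R.
  apply: eq_bigr => k _; rewrite degree_hub // /green /= eqxx /gap subnn /psi /parabola.
  by field.
(* The base vertex has position 0, so the gap to any vertex is that vertex's position. *)
set x0 := rail false _.
have -> : \sum_i ((degree (@chain tw n) (rail false i))%:R * green s3 psi y x0 (rail false i)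
   + (degree (@chain tw n) (rail true i))%:R * green s3 psi y x0 (rail true i))
   = \sum_(i < 2 * n) (6 * parabola R n i + (if odd i then 0 else 3 / 2)).
  apply: eq_bigr => i _; rewrite !degree_rail // /green !pos_rail !level_rail !charge_rail.
  rewrite !hub_peak_rail /gap sub0n add0n subn0 -/(psi i).
  by case: (odd i); rewrite expr1 expr0 /=; field.
have -> : \sum_k (degree (@chain tw n) (inr k))%:R * green s3 psi y x0 (inr k)
   = \sum_(k < n) (2 * parabola R n (2 * k).+1 - 2) :> R.
  apply: eq_bigr => k _; rewrite degree_hub // /green /= /gap sub0n add0n subn0 -/(psi _).
  by field.
rewrite !sum_alternating !big_split /= !sumr_const card_ord !sum_alternating.
rewrite -mulr_sumr sum_parabola -mulr_sumr sum_parabola_odd.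
by field.
Qed.

(** * Closed form of [y 0] from the characteristic roots *)

Lemma chain_kirchhoff_closed (R : rcfType) (tw : bool) (n : nat) :
  (1 < n)%N ->
  let a : R := (Num.sqrt 3%:R + Num.sqrt 2%:R) ^+ (2 * n) in
  let b : R := (Num.sqrt 3%:R - Num.sqrt 2%:R) ^+ (2 * n) in
  degree_kirchhoff R (@chain tw n)
  = 14%:R * n%:R
    * ((49%:R * n%:R ^+ 2 + 42%:R * n%:R - 19%:R) / 42%:R
       + (7%:R * Num.sqrt 6%:R * n%:R / 8%:R * (a - b))
         / (a + b - 2%:R * (-1) ^+ tw)).
Proof.
move=> n_gt1.
have sqrt_sqr k : Num.sqrt k%:R * Num.sqrt k%:R = k%:R :> R.
  by rewrite -expr2 sqr_sqrtr ?ler0n.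
have s6E : Num.sqrt 6%:R = Num.sqrt 2%:R * Num.sqrt 3%:R :> R.
  by rewrite -sqrtrM ?ler0n // -natrM.
have := sqrt_sqr 2%N; have := sqrt_sqr 3%N; rewrite s6E.
have s2_gt0 : 0 < Num.sqrt 2%:R :> R by rewrite sqrtr_gt0 ltr0n.
have s3_gt1 : 1 < Num.sqrt 3%:R :> R by rewrite -{1}sqrtr1 ltr_sqrt ?ltr1n ?ltr0n.
move: s2_gt0 s3_gt1; set s2 := Num.sqrt 2%:R; set s3 := Num.sqrt 3%:R.
set p := s3 + s2; set q := s3 - s2 => s2_gt0 s3_gt1 s3_sqr s2_sqr a b.
have pq : q * p = 1 by rewrite /p /q; ring: s2_sqr s3_sqr.
have p_gt1 : 1 < p by rewrite /p -[1]addr0 ltrD.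
have p_gt0 : 0 < p := lt_trans ltr01 p_gt1.
have qE : q = p^-1 by rewrite -[q]mulr1 -(mulfV (lt0r_neq0 p_gt0)) mulrA pq mul1r.
have q_gt0 : 0 < q by rewrite qE invr_gt0.
have q_lt1 : q < 1 by rewrite qE invf_lt1.
have b_gt0 : 0 < b by rewrite exprn_gt0.
have b_lt1 : b < 1 by rewrite exprn_ilt1 ?ltW //; lia.
have aE : a = b^-1 by rewrite /b qE exprVn invrK.
have e_sqr : (-1) ^+ tw * (-1) ^+ tw = 1 :> R by rewrite -signr_addb addbb.
have den_neq0 : 1 - (-1) ^+ tw * b != 0 by case: tw {e_sqr}; rewrite gt_eqF // ?expr1 ?expr0; lra.
move: e_sqr den_neq0; set eps := (-1) ^+ tw => e_sqr den_neq0.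
(* The jump condition on [y 1] forces [K]: its left side minus [2 * s3 * y 0] is
   [- 2 * s2 * K * (1 - eps * b)]. *)
pose K := 7 * n%:R * (s2 * s3) / (24 * (1 - eps * b)).
(* As [p * q = 1], reflection exchanges [q ^+ k] with [b * p ^+ k], so the coefficient [eps * b]
   yields the sign [eps]. *)
pose y k := K * (q ^+ k + eps * b * p ^+ k).
rewrite (@chain_kirchhoff R tw n s3 y) //; first last.
- move=> k le; rewrite /y -/eps mulrCA; congr (_ * _).
  have -> : q ^+ (2 * n - k) = b * p ^+ k.
    by rewrite /b -{2}(subnK le) exprD -mulrA -exprMn pq expr1n mulr1.
  have bp : b * p ^+ (2 * n - k) = q ^+ k.
    by rewrite /b -{1}(subnKC le) exprD -mulrA -exprMn pq expr1n mulr1.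
  by rewrite -[eps * b * _]mulrA bp; ring: e_sqr.
- move=> k; rewrite /y !exprS /p /q; ring: s2_sqr s3_sqr.
- rewrite /y /K !expr1 !expr0 /p /q; field: s2_sqr s3_sqr.
  by [].
congr (_ * (_ + _)).
(* With [a * b = 1] and [eps * eps = 1] both expressions factor, and their quotient is
   [(1 + eps * b) / (1 - eps * b)]. *)
have -> : a - b = a * ((1 - eps * b) * (1 + eps * b)).
  rewrite aE; field: e_sqr; exact: lt0r_neq0.
have -> : a + b - 2 * eps = a * ((1 - eps * b) * (1 - eps * b)).
  rewrite aE; field: e_sqr; exact: lt0r_neq0.
rewrite /y /K !expr0 aE; field.
by rewrite den_neq0 lt0r_neq0.
Qed.

Theorem theorem6 (R : rcfType) (n : nat) (hn : (2 <= n)%N) :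
  let s2 : R := Num.sqrt 2%:R in
  let s3 : R := Num.sqrt 3%:R in
  let s6 : R := Num.sqrt 6%:R in
  let N : R := n%:R in
  let a : R := (s3 + s2) ^+ (2 * n) in
  let b : R := (s3 - s2) ^+ (2 * n) in
  degree_kirchhoff R (@pentagonal_cylinder n)
    = 14%:R * N
      * ((49%:R * N ^+ 2 + 42%:R * N - 19%:R) / 42%:R
         + (7%:R * s6 * N / 8%:R * (a - b)) / (a + b - 2%:R))
  /\
  degree_kirchhoff R (@pentagonal_moebius n)
    = 14%:R * N
      * ((49%:R * N ^+ 2 + 42%:R * N - 19%:R) / 42%:R
         + (7%:R * s6 * N / 8%:R * (a - b)) / (a + b + 2%:R)).
Proof.
move=> s2 s3 s6 N a b; split.
  by have := chain_kirchhoff_closed R false hn; rewrite expr0 mulr1.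
by have := chain_kirchhoff_closed R true hn; rewrite expr1 mulrN1 opprK.
Qed.
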